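(* Let $n,m\in\mathbb{N}$, let $A\in\{0,1\}^{n\times m}$ have no zero column, let $\{\mathbf{0}_m,\mathbf{e}_1,\dots,\mathbf{e}_m\}\subseteq X\subseteq\mathbb{R}^m_+$, and let $f:X\to\mathbb{R}$ satisfy $f(\mathbf{0}_m)=0$ and be individually superadditive, i.e. $f(x)\ge\sum_{j=1}^m f(\mathbf{e}_j)x_j$ for all $x\in X$. For $w\in\{0,1\}^n$ define the covering (cost) game and its relaxation $$\nu^{\mathrm{cov}}_{X,f}(w)=\min_{x\in X}[f(x):Ax\ge w]\in\mathbb{R},\qquad \nu^{\mathrm{cov}}_{\mathbb{R}^m_+,F}(w)=\min_{x\in\mathbb{R}^m_+}\left[(f(\mathbf{e}_1),\dots,f(\mathbf{e}_m))x:Ax\ge w\right].$$ Then $$\mathrm{core}(\nu^{\mathrm{cov}}_{X,f})\ne\emptyset\iff \nu^{\mathrm{cov}}_{X,f}(\mathbf{1}_n)=\nu^{\mathrm{cov}}_{\mathbb{R}^m_+,F}(\mathbf{1}_n).$$ Moreover, whenever the core is non-empty, $$\mathrm{core}(\nu^{\mathrm{cov}}_{X,f})=\operatorname*{arg\,max}_{y\in\mathbb{R}^n_+}\left[\mathbf{1}_n^Ty:\ y^TA\le(f(\mathbf{e}_1),\dots,f(\mathbf{e}_m))\right].$$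
   Context: Notation: $\mathbf{0}_n,\mathbf{1}_n$ are the all-zero and all-one vectors in $\mathbb{R}^n$; $\mathbf{e}_j$ is the $j$-th unit vector; $\mathbb{R}^m_+$ is the set of componentwise non-negative vectors; vector inequalities are componentwise. Standing convention: for every $w\in\{0,1\}^n$ the program defining $\nu^{\mathrm{cov}}_{X,f}(w)$ is feasible and its minimum is attained, so $\nu^{\mathrm{cov}}_{X,f}$ is real-valued; the relaxed linear program has value $-\infty$ if it is unbounded below. For a cost game $\nu:\{0,1\}^n\to\mathbb{R}$ the core is $\mathrm{core}(\nu)=\{y\in\mathbb{R}^n:\mathbf{1}_n^Ty=\nu(\mathbf{1}_n),\ a^Ty\le\nu(a)\ \forall a\in\{0,1\}^n\}$. *)

(* Defs.v *)
From HB Require Import structures.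
From mathcomp Require Import all_boot all_order all_algebra.
From mathcomp Require Import classical_sets reals constructive_ereal ereal.

Set Implicit Arguments.
Unset Strict Implicit.
Unset Printing Implicit Defensive.

Import Order.TTheory GRing.Theory Num.Theory.
Local Open Scope classical_set_scope.
Local Open Scope ring_scope.

Section Definitions.
Context {R : realType}.

Definition zero_one p q (M : 'M[R]_(p, q)) : Prop :=
  forall i j, M i j = 0 \/ M i j = 1.

Definition lemx p q (M N : 'M[R]_(p, q)) : Prop :=
  forall i j, M i j <= N i j.

Definition ones p : 'cV[R]_p := const_mx 1.

Definition unitv p (j : 'I_p) : 'cV[R]_p := delta_mx j 0.

Definition dot p (x y : 'cV[R]_p) : R := (x^T *m y) 0 0.

Definition nonneg p : set 'cV[R]_p := [set x | lemx 0 x].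

Definition argmin T (D : set T) (g : T -> R) : set T :=
  [set x | D x /\ forall z, D z -> g x <= g z].

Definition argmax T (D : set T) (g : T -> R) : set T :=
  [set x | D x /\ forall z, D z -> g z <= g x].

(* A game on {0,1}^n is a function on all of R^n of which only the values at
   0/1 vectors matter. *)
Definition core n (nu : 'cV[R]_n -> R) : set 'cV[R]_n :=
  [set y | dot (ones n) y = nu (ones n) /\
           forall a, zero_one a -> dot a y <= nu a].

Section Covering.
Variables (n m : nat) (A : 'M[R]_(n, m)).

Definition cov_feasible (X : set 'cV[R]_m) (w : 'cV[R]_n) : set 'cV[R]_m :=
  [set x | X x /\ lemx w (A *m x)].

(* Optimal value of min_{x in X} [f(x) : A x >= w] in the extended reals: it is
   the minimum when that is attained, and -oo when the program is unbounded
   below. Only the values of f on X matter. *)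
Definition cov_value (X : set 'cV[R]_m) (f : 'cV[R]_m -> R) (w : 'cV[R]_n) :
    \bar R :=
  ereal_inf [set (f x)%:E | x in cov_feasible X w].

(* The real-valued cost game; [fine] loses nothing when the minima are
   attained, which makes every [cov_value] at a 0/1 vector finite. *)
Definition cov_game (X : set 'cV[R]_m) (f : 'cV[R]_m -> R) (w : 'cV[R]_n) : R :=
  fine (cov_value X f w).

Definition dual_feasible (c : 'rV[R]_m) : set 'cV[R]_n :=
  [set y | nonneg y /\ lemx (y^T *m A) c].

End Covering.

Definition unit_costs m (f : 'cV[R]_m -> R) : 'rV[R]_m := \row_j f (unitv j).

Definition linear_cost m (c : 'rV[R]_m) (x : 'cV[R]_m) : R := (c *m x) 0 0.

Definition individually_superadditive m (X : set 'cV[R]_m)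
    (f : 'cV[R]_m -> R) : Prop :=
  forall x, X x -> \sum_j f (unitv j) * x j 0 <= f x.

End Definitions.

Arguments nonneg {R} p.
Arguments ones {R} p.

(* Main.v *)
Require Import Defs.
From HB Require Import structures.
From mathcomp Require Import all_boot all_order all_algebra.
From mathcomp Require Import classical_sets reals constructive_ereal ereal.
From mathcomp Require Import boolp.
From mathcomp Require Import lra.

(** Write [c] for the vector of unit costs [f (unitv j)].  A core vector [y] is
    nonnegative, because dropping a player never increases the minimal cost,
    and satisfies [y^T A <= c], because column [j] of [A] is a coalition that
    [unitv j] covers.  Conversely, let [y] be feasible for the dual program
    with [1^T y = nu(1)].  If [x] is optimal for a coalition [a], then
    [a^T y <= y^T A x <= c x <= f x = nu(a)], so [y] is in the core.  Hence the
    core consists of the dual feasible vectors of value [nu(1)]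
    ([core_dual_feasible]).

    By weak duality and superadditivity, every dual value is at most the
    relaxed minimum, which is at most [nu(1)].  A core vector therefore forces
    equality and is dual optimal.  If, conversely, the relaxed minimum equals
    [nu(1)], it is attained at any optimal [x] in [X], and strong duality
    ([lp_strong_duality]) gives a dual feasible vector of value [nu(1)], that
    is, a core vector.  Strong duality is derived from Farkas' lemma
    ([farkas]), which is proved by induction on the number of inequalities. *)

Set Implicit Arguments.
Unset Strict Implicit.
Unset Printing Implicit Defensive.

Import Order.TTheory GRing.Theory Num.Theory.
Local Open Scope classical_set_scope.
Local Open Scope ring_scope.

(** * Farkas' lemma and linear programming duality *)

Section LinearProgramming.
Context {R : realType}.

Lemma lemx_mulr p q r (M N : 'M[R]_(p, q)) (B : 'M[R]_(q, r)) :
  lemx M N -> lemx 0 B -> lemx (M *m B) (N *m B).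
Proof.
move=> MN B0 i j; rewrite !mxE; apply: ler_sum => k _.
by apply: ler_wpM2r (MN i k); have := B0 k j; rewrite mxE.
Qed.

Lemma lemx_mull p q r (M N : 'M[R]_(q, r)) (B : 'M[R]_(p, q)) :
  lemx M N -> lemx 0 B -> lemx (B *m M) (B *m N).
Proof.
move=> MN B0 i j; rewrite !mxE; apply: ler_sum => k _.
by apply: ler_wpM2l (MN k j); have := B0 i k; rewrite mxE.
Qed.

Lemma lemx_tr p q (M N : 'M[R]_(p, q)) : lemx M N -> lemx M^T N^T.
Proof. by move=> MN i j; rewrite !mxE. Qed.

Lemma dotC p (x y : 'cV[R]_p) : dot x y = dot y x.
Proof. by rewrite /dot -[in LHS](trmxK y) -trmx_mul mxE. Qed.

Lemma col_mx_le0 p1 p2 q (M : 'M[R]_(p1, q)) (N : 'M[R]_(p2, q)) :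
  lemx M 0 -> lemx N 0 -> lemx (col_mx M N) 0.
Proof.
move=> M0 N0 i j; rewrite -col_mx0 !mxE.
by case: split => k; [exact: M0|exact: N0].
Qed.

Lemma row_mx_ge0 p q1 q2 (M : 'M[R]_(p, q1)) (N : 'M[R]_(p, q2)) :
  lemx 0 M -> lemx 0 N -> lemx 0 (row_mx M N).
Proof.
move=> M0 N0 i j; rewrite -row_mx0 !mxE.
by case: split => k; [exact: M0|exact: N0].
Qed.

(** Farkas' lemma: a linear form that is nonpositive on a polyhedral cone is a
    nonnegative combination of the forms defining the cone. *)
Lemma farkas p q (M : 'M[R]_(p, q)) (g : 'rV[R]_q) :
  (forall x : 'cV[R]_q, lemx (M *m x) 0 -> (g *m x) 0 0 <= 0) ->
  exists2 l : 'rV[R]_p, lemx 0 l & g = l *m M.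
Proof.
elim: p M g => [|p IHp] M g gM.
  exists 0; first by move=> i [].
  rewrite mul0mx; apply/rowP=> j; rewrite [RHS]mxE.
  have gj s : s * g 0 j <= 0.
    have Ms : lemx (M *m (s *: (delta_mx j 0 : 'cV[R]_q))) 0 by move=> i; case: i.
    by have := gM _ Ms; rewrite -scalemxAr -colE !mxE.
  by have := gj 1; have := gj (-1); lra.
move: M gM; rewrite -[p.+1]/(1 + p)%N => M.
rewrite -(vsubmxK M); set a := usubmx M; set N := dsubmx M => gM.
have [gN|] := pselect (forall x : 'cV[R]_q, lemx (N *m x) 0 -> (g *m x) 0 0 <= 0).
  have [l l0 ->] := IHp _ _ gN.
  exists (row_mx 0 l); last by rewrite mul_row_col mul0mx add0r.
  by apply: row_mx_ge0.
move=> /existsNP[z /not_implyP[Nz /negP]]; rewrite -ltNge => gz.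
have az : 0 < (a *m z) 0 0.
  rewrite ltNge; apply/negP=> az; move: gz; rewrite ltNge => /negP; apply.
  apply: gM; rewrite mul_col_mx; apply: col_mx_le0 => // i j.
  by rewrite !ord1 [X in _ <= X]mxE.
(* The point [z], scaled so that [a] takes the value 1 there, projects every
   vector along [z] onto the kernel of [a]. *)
pose x0 := ((a *m z) 0 0)^-1 *: z.
have ax0 : a *m x0 = 1%:M.
  apply/matrixP=> i j; rewrite !ord1 /x0 -scalemxAr mxE mulVf ?gt_eqF//.
  by rewrite mxE eqxx.
have Nx0 : lemx (N *m x0) 0.
  move=> i j; rewrite -scalemxAr mxE [X in _ <= X]mxE pmulr_rle0 ?invr_gt0//.
  by have := Nz i j; rewrite [X in _ <= X]mxE.
have gx0 : 0 < (g *m x0) 0 0 by rewrite -scalemxAr mxE mulr_gt0 ?invr_gt0.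
have [l l0 lE] : exists2 l : 'rV[R]_p, lemx 0 l &
    g - g *m x0 *m a = l *m (N - N *m x0 *m a).
  apply: IHp => x Nx.
  have -> : (g - g *m x0 *m a) *m x = g *m (x - x0 *m (a *m x)).
    by rewrite mulmxBl mulmxBr !mulmxA.
  apply: gM; rewrite mul_col_mx; apply: col_mx_le0.
    by rewrite mulmxBr [a *m (x0 *m _)]mulmxA ax0 mul1mx subrr.
  by move: Nx; rewrite mulmxBl mulmxBr !mulmxA.
pose b := g *m x0 - l *m (N *m x0).
have b0 : lemx 0 b.
  move=> i j; rewrite !ord1 [X in X <= _]mxE [X in _ <= X]mxE [X in _ + X]mxE.
  have := lemx_mull Nx0 l0 0 0; rewrite mulmx0 [X in _ <= X]mxE; lra.
exists (row_mx b l); first exact: row_mx_ge0.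
rewrite mul_row_col mulmxBl -[LHS](subrK (g *m x0 *m a)) lE mulmxBr !mulmxA.
by rewrite addrC addrA addrAC.
Qed.

Lemma lp_weak_duality n m (A : 'M[R]_(n, m)) (w : 'cV[R]_n) (c : 'rV[R]_m)
    (x : 'cV[R]_m) (y : 'cV[R]_n) :
  cov_feasible A (nonneg m) w x -> dual_feasible A c y ->
  dot w y <= linear_cost c x.
Proof.
move=> [x0 wAx] [y0 yAc]; rewrite dotC /linear_cost.
apply: le_trans (lemx_mulr yAc x0 0 0); rewrite -mulmxA.
by apply: (lemx_mull wAx); have := lemx_tr y0; rewrite trmx0.
Qed.

(** If a covering program attains its minimum, some dual feasible vector has
    the same value.  Farkas' lemma is applied to the homogenized program in the
    variables [(z, s)]: the constraints [z >= 0], [s >= 0] and [A z >= s w]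
    imply [v s <= c z], where [v] is the optimal value. *)
Lemma lp_strong_duality n m (A : 'M[R]_(n, m)) (w : 'cV[R]_n) (c : 'rV[R]_m)
    (x : 'cV[R]_m) :
  argmin (cov_feasible A (nonneg m) w) (linear_cost c) x ->
  exists2 y, dual_feasible A c y & dot w y = linear_cost c x.
Proof.
move=> [xfeas xmin]; set v := linear_cost c x.
pose M := col_mx (- 1%:M : 'M[R]_(m + 1)) (row_mx (- A) w).
have [u|l l0 lE] := @farkas _ _ M (row_mx (- c) v%:M).
  rewrite -(vsubmxK u); move: (usubmx u) (dsubmx u) => z s Mu.
  rewrite mul_row_col mulNmx mul_scalar_mx.
  have z0 : lemx 0 z.
    move=> i j; have := Mu (lshift n (lshift 1 i)) j.
    by rewrite mul_col_mx col_mxEu mulNmx mul1mx [X in X <= _]mxE col_mxEu !mxE oppr_le0.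
  have s0 : 0 <= s 0 0.
    have := Mu (lshift n (rshift m 0)) 0.
    by rewrite mul_col_mx col_mxEu mulNmx mul1mx [X in X <= _]mxE col_mxEd !mxE oppr_le0.
  have Az i : s 0 0 * w i 0 <= (A *m z) i 0.
    have := Mu (rshift (m + 1) i) 0.
    rewrite mul_col_mx col_mxEd mul_row_col mulNmx [s]mx11_scalar mul_mx_scalar.
    by rewrite !mxE eqxx mulr1n; lra.
  suff : v * s 0 0 <= linear_cost c z.
    by rewrite /linear_cost [in X in _ -> X]mxE [X in X + _]mxE [X in _ + X]mxE; lra.
  have [s_eq0|s_neq0] := eqVneq (s 0 0) 0.
    (* If [s = 0], then [z] is a recession direction: [x + z] is feasible. *)
    have : v <= linear_cost c (x + z).
      apply: xmin; case: xfeas => x0 wAx; split => [i j|i j].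
        by have := x0 i j; have := z0 i j; rewrite !mxE => ? ?; rewrite addr_ge0.
      rewrite mulmxDr ord1 mxE; have := wAx i 0; have := Az i.
      by rewrite s_eq0 mul0r; lra.
    by rewrite s_eq0 mulr0 /linear_cost mulmxDr mxE -/(linear_cost c x) -/v; lra.
  have s_gt0 : 0 < s 0 0 by rewrite lt_def s_neq0.
  have : v <= linear_cost c ((s 0 0)^-1 *: z).
    apply: xmin; split => [i j|i j].
      by rewrite !mxE mulr_ge0 ?invr_ge0//; have := z0 i j; rewrite mxE.
    by rewrite ord1 -scalemxAr mxE ler_pdivlMl.
  by rewrite /linear_cost -scalemxAr mxE ler_pdivlMl// mulrC.
move: l0 lE; rewrite -(hsubmxK l); move: (lsubmx l) (rsubmx l) => k y l0.
rewrite mul_row_col mulmxN mulmx1 mul_mx_row -(hsubmxK k).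
rewrite opp_row_mx add_row_mx => /eq_row_mx[cE vE].
have k0 i j : 0 <= k i j.
  by have := l0 i (lshift n j); rewrite row_mxEl mxE.
have y0 i j : 0 <= y i j.
  by have := l0 i (rshift (m + 1) j); rewrite row_mxEr mxE.
have ydual : dual_feasible A c y^T.
  split=> [i j|i j]; first by rewrite !mxE.
  rewrite trmxK; move/matrixP/(_ i j): cE.
  by rewrite mulmxN !mxE; have := k0 i (lshift 1 j); lra.
exists y^T => //; apply/eqP; rewrite eq_le (lp_weak_duality xfeas)//=.
rewrite dotC /dot trmxK; move/matrixP/(_ 0 0): vE.
by rewrite !mxE eqxx mulr1n => ->; have := k0 0 (rshift m 0); lra.
Qed.

End LinearProgramming.

(** * The core of a covering game *)

Section CoveringGame.
Context {R : realType}.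
Variables (n m : nat) (A : 'M[R]_(n, m)).

Lemma cov_value_argmin (X : set 'cV[R]_m) (f : 'cV[R]_m -> R)
    (w : 'cV[R]_n) (x : 'cV[R]_m) :
  argmin (cov_feasible A X w) f x -> cov_value A X f w = (f x)%:E.
Proof.
move=> [xfeas xmin]; apply/eqP; rewrite eq_le; apply/andP; split.
  by apply: ereal_inf_lbound; exists x.
by apply: le_ereal_inf_tmp => _ [z zfeas <-]; rewrite lee_fin xmin.
Qed.

Lemma cov_value_le (X : set 'cV[R]_m) (f : 'cV[R]_m -> R)
    (w : 'cV[R]_n) (x : 'cV[R]_m) :
  cov_feasible A X w x -> (cov_value A X f w <= (f x)%:E)%E.
Proof. by move=> xfeas; apply: ereal_inf_lbound; exists x. Qed.

Lemma zero_one_ones : zero_one (ones n : 'cV[R]_n).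
Proof. by move=> i j; right; rewrite mxE. Qed.

Variables (X : set 'cV[R]_m) (f : 'cV[R]_m -> R).
Hypothesis A_zero_one : zero_one A.
Hypothesis X_unit : forall j, X (unitv j).
Hypothesis X_nonneg : X `<=` nonneg m.
Hypothesis f_superadd : individually_superadditive X f.
Hypothesis min_attained : forall w : 'cV[R]_n, zero_one w ->
  argmin (cov_feasible A X w) f !=set0.

Local Notation nu := (cov_game A X f).
Local Notation c := (unit_costs f).

Lemma cov_game_argmin (w : 'cV[R]_n) (x : 'cV[R]_m) :
  argmin (cov_feasible A X w) f x -> nu w = f x.
Proof. by move=> /cov_value_argmin; rewrite /cov_game => ->. Qed.

Lemma cov_game_le (w : 'cV[R]_n) (x : 'cV[R]_m) :
  zero_one w -> cov_feasible A X w x -> nu w <= f x.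
Proof.
by move=> /min_attained[z zmin] xfeas; rewrite (cov_game_argmin zmin) zmin.2.
Qed.

Lemma linear_cost_le (x : 'cV[R]_m) : X x -> linear_cost c x <= f x.
Proof.
move=> /f_superadd; rewrite /linear_cost mxE.
by under [in X in _ -> X]eq_bigr do rewrite mxE.
Qed.

Lemma cov_feasible_relax (w : 'cV[R]_n) (x : 'cV[R]_m) :
  cov_feasible A X w x -> cov_feasible A (nonneg m) w x.
Proof. by move=> [Xx ?]; split=> //; exact: X_nonneg. Qed.

(** The coalition that omits player [i] costs at most as much as the grand
    coalition, so the core inequality for it bounds [y i] from below by 0. *)
Lemma core_ge0 (y : 'cV[R]_n) : core nu y -> nonneg n y.
Proof.
move=> [y1 ynu] i j; rewrite ord1 mxE.
pose w : 'cV[R]_n := ones n - unitv i.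
have w01 : zero_one w.
  by move=> k l; rewrite !mxE; case: (_ && _); [left|right]; rewrite ?subrr ?subr0.
have [x xmin] := min_attained zero_one_ones.
have nuw : nu w <= nu (ones n).
  rewrite (cov_game_argmin xmin); apply: cov_game_le => //.
  case: xmin => -[Xx Ax] _; split=> // k l; apply: le_trans (Ax k l).
  by rewrite !mxE lerBlDr lerDl ler0n.
have := ynu _ w01; rewrite dotC /dot mulmxBr mxE -/(dot y (ones n)) dotC y1.
by rewrite mxE -colE !mxE; lra.
Qed.

Lemma core_dual_feasible :
  core nu = dual_feasible A c `&` [set y | dot (ones n) y = nu (ones n)].
Proof.
apply/seteqP; split=> [y ycore|y [ydual y1]].
  split; last by case: ycore.
  split=> [|i j]; first exact: core_ge0.
  have colA01 : zero_one (col j A) by move=> k l; rewrite mxE.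
  rewrite !ord1 [X in _ <= X]mxE.
  have -> : (y^T *m A) 0 j = dot (col j A) y.
    by rewrite dotC /dot colE mulmxA -colE [RHS]mxE.
  apply: le_trans (ycore.2 _ colA01) _; apply: cov_game_le => //.
  by split=> // k l; rewrite colE.
split=> // a /min_attained[x xmin]; rewrite (cov_game_argmin xmin).
apply: le_trans (linear_cost_le xmin.1.1).
exact: lp_weak_duality (cov_feasible_relax xmin.1) ydual.
Qed.

Lemma core_nonempty_iff :
  core nu !=set0 <->
  cov_value A X f (ones n) = cov_value A (nonneg m) (linear_cost c) (ones n).
Proof.
have [x xmin] := min_attained zero_one_ones.
have xfeas := cov_feasible_relax xmin.1.
have cx_le := linear_cost_le xmin.1.1.
rewrite core_dual_feasible (cov_value_argmin xmin); split=> [[y [ydual]]|E].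
  rewrite /= (cov_game_argmin xmin) => y1.
  have dual_le z : cov_feasible A (nonneg m) (ones n) z ->
      f x <= linear_cost c z.
    by move=> zfeas; rewrite -y1; exact: lp_weak_duality zfeas ydual.
  have cxE : linear_cost c x = f x by apply/eqP; rewrite eq_le cx_le dual_le.
  rewrite (@cov_value_argmin _ _ _ x) ?cxE//; split=> // z /dual_le.
  by rewrite cxE.
have f_le z : cov_feasible A (nonneg m) (ones n) z -> f x <= linear_cost c z.
  by move=> zfeas; rewrite -lee_fin E; exact: cov_value_le.
have [|y ydual y1] := @lp_strong_duality _ _ _ A (ones n) c x.
  by split=> // z /f_le; apply: le_trans.
exists y; split=> //=; rewrite y1 (cov_game_argmin xmin).
by apply/eqP; rewrite eq_le cx_le f_le.
Qed.

Lemma core_argmax :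
  core nu !=set0 -> core nu = argmax (dual_feasible A c) (dot (ones n)).
Proof.
have [x xmin] := min_attained zero_one_ones.
have dual_le y : dual_feasible A c y -> dot (ones n) y <= nu (ones n).
  move=> ydual; rewrite (cov_game_argmin xmin).
  apply: le_trans (linear_cost_le xmin.1.1).
  exact: lp_weak_duality (cov_feasible_relax xmin.1) ydual.
rewrite core_dual_feasible => -[y0 [y0dual y01]].
apply/seteqP; split=> y [ydual].
  by move=> y1; split=> // z /dual_le; rewrite -y1.
move=> ymax; split=> //; apply/eqP; rewrite eq_le dual_le//=.
by rewrite -y01 ymax.
Qed.

End CoveringGame.

Theorem theorem4 (R : realType) (n m : nat) (A : 'M[R]_(n, m))
    (X : set 'cV[R]_m) (f : 'cV[R]_m -> R)
    (A_zero_one : zero_one A)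
    (A_col_neq0 : forall j, col j A <> 0)
    (X_0 : X 0)
    (X_unit : forall j, X (unitv j))
    (X_nonneg : X `<=` nonneg m)
    (f_0 : f 0 = 0)
    (f_superadd : individually_superadditive X f)
    (min_attained : forall w : 'cV[R]_n, zero_one w ->
       argmin (cov_feasible A X w) f !=set0) :
  (core (cov_game A X f) !=set0 <->
     cov_value A X f (ones n) =
     cov_value A (nonneg m) (linear_cost (unit_costs f)) (ones n)) /\
  (core (cov_game A X f) !=set0 ->
     core (cov_game A X f) =
     argmax (dual_feasible A (unit_costs f)) (dot (ones n))).
Proof.
split; first exact: core_nonempty_iff.
exact: core_argmax.
Qed.
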